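(* Let $n$ and $k$ be integers with $k \ge 1$ and $n > 2k$. Then there are $k$ simple graphs $G_0(n,k), G_1(n,k), \dots, G_{k-1}(n,k)$ such that $G_0(n,k) = K(n,k)$, such that $K_2 \times G_i(n,k) \cong H(n,k)$ for every $i = 0, 1, \dots, k-1$, and such that any two of them are not isomorphic (i.e. $G_i(n,k) \not\cong G_j(n,k)$ whenever $i \neq j$).
   Context: A graph is a pair $G = (V(G), E(G))$ of a set $V(G)$ together with a symmetric binary relation $E(G)$ on $V(G)$; $v \sim_G w$ means $(v,w) \in E(G)$. Loops are allowed in general; $G$ is simple if no vertex is adjacent to itself. A graph homomorphism $f\colon G \to H$ is a map $V(G) \to V(H)$ such that $v \sim_G w$ implies $f(v) \sim_H f(w)$; an isomorphism is a graph homomorphism having an inverse that is a graph homomorphism. The categorical product $G \times H$ has vertex set $V(G) \times V(H)$, with $(v,w) \sim_{G\times H} (v',w')$ if and only if $v \sim_G v'$ and $w \sim_H w'$. $K_2$ is the complete graph on the two vertices $1, 2$. The Kronecker cover of $G$ is $K_2 \times G$. For positive integers $n > 2k$, the Kneser graph $K(n,k)$ has as vertices the $k$-element subsets of $[n] = \{1, \dots, n\}$, two of them being adjacent if and only if they are disjoint. The bipartite Kneser graph is $H(n,k) = K_2 \times K(n,k)$. *)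

(* Defs.v *)
From mathcomp Require Import all_boot.

Set Implicit Arguments.
Unset Strict Implicit.
Unset Printing Implicit Defensive.

(* Vertex sets may be infinite and loops are allowed. *)
Record graph := Graph {
  vertex :> Type;
  adj : vertex -> vertex -> Prop;
  adj_sym : forall v w, adj v w -> adj w v
}.

Arguments adj : clear implicits.

Definition simple_graph (G : graph) : Prop := forall v : G, ~ adj G v v.

Definition graph_hom (G H : graph) (f : G -> H) : Prop :=
  forall v w : G, adj G v w -> adj H (f v) (f w).

Definition graph_isom (G H : graph) (f : G -> H) : Prop :=
  graph_hom f /\
  exists g : H -> G, [/\ graph_hom g, cancel f g & cancel g f].

Definition isomorphic (G H : graph) : Prop :=
  exists f : G -> H, graph_isom f.

Section CategoricalProduct.

Variables G H : graph.

Definition prod_adj (x y : G * H) : Prop :=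
  adj G x.1 y.1 /\ adj H x.2 y.2.

Lemma prod_adj_sym (x y : G * H) : prod_adj x y -> prod_adj y x.
Proof. by case=> h1 h2; split; apply: adj_sym. Qed.

Definition graph_prod : graph := Graph prod_adj_sym.

End CategoricalProduct.

Section CompleteGraph.

Variable n : nat.

Definition complete_adj (i j : 'I_n) : Prop := i <> j.

Lemma complete_adj_sym (i j : 'I_n) : complete_adj i j -> complete_adj j i.
Proof. by move=> h e; apply: h. Qed.

Definition complete_graph : graph := Graph complete_adj_sym.

End CompleteGraph.

Definition kronecker_cover (G : graph) : graph :=
  graph_prod (complete_graph 2) G.

Section KneserGraph.

Variables n k : nat.

(* The ground set [n] is represented by 'I_n = {0, ..., n-1}. *)
Definition kneser_vertex : Type := {A : {set 'I_n} | #|A| == k}.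

Definition kneser_adj (A B : kneser_vertex) : Prop :=
  [disjoint val A & val B].

Lemma kneser_adj_sym (A B : kneser_vertex) :
  kneser_adj A B -> kneser_adj B A.
Proof. by rewrite /kneser_adj disjoint_sym. Qed.

Definition kneser_graph : graph := Graph kneser_adj_sym.

End KneserGraph.

Definition bipartite_kneser_graph (n k : nat) : graph :=
  kronecker_cover (kneser_graph n k).

(* Main.v *)
Require Import Defs.
From mathcomp Require Import all_boot.
From mathcomp Require Import zify.
From Stdlib Require Import FunctionalExtensionality ProofIrrelevance.

(** Let [s] be an involution of the ground set.  Declaring two [k]-sets [A] and
    [B] adjacent when [A] misses [s @: B] gives a graph whose Kronecker cover
    does not depend on [s]: applying [s] to the [k]-sets of one of the two
    sheets turns it into the cover obtained for the identity, which is the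
    bipartite Kneser graph.  The graphs wanted are those of the involutions
    [block_swap i] with [i < k], products of [i] disjoint transpositions; the
    first of them is the identity and gives the Kneser graph.

    The parameter [i] is read off from the edges.  If [C] misses [s @: C], then
    [C] and [s @: C] are disjoint sets of points moved by [s], so that
    [#|C| <= i] ([card_disjoint_imset]).  Taking [C] to be a [k]-set, this
    forbids loops.  Taking [C = A :&: B] for an edge [A], [B], it bounds by [i]
    the intersection of adjacent [k]-sets, and the bound is attained
    ([block_swap_edge]).

    It remains to see that the graph structure knows enough about
    intersections.  Two vertices [A], [B] have ['C(n - #|A :|: B|, k)] common
    neighbours, whatever [s] is, and since [2 * k < n] this number detects
    whether [A] and [B] share at least [k - 1] points.  An injective
    homomorphism cannot decrease the number of common neighbours, so it is a
    homomorphism for the Johnson graph, hence does not increase the Johnson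
    distance [k - #|A :&: B|] ([leq_card_setI_hom]).  Applied to an edge that
    attains the bound [i], this shows that an injective homomorphism from the
    [i]-th graph to the [j]-th one exists only if [i <= j]. *)

Set Implicit Arguments.
Unset Strict Implicit.
Unset Printing Implicit Defensive.

(** * Finite sets and binomial coefficients *)

Lemma ltn_bin2l m p k : 0 < k -> k <= p -> m < p -> 'C(m, k) < 'C(p, k).
Proof.
case: k => // k _ lekp; case: p lekp => // p lekp ltmp.
by rewrite binS -addn1 leq_add ?leq_bin2l ?bin_gt0.
Qed.

Lemma card_ord_interval n a b :
  b <= n -> #|[set x : 'I_n | a <= x < b]| = b - a.
Proof.
move=> lebn; rewrite cardsE -sum1_card -[RHS]muln1 -sum_nat_const_nat.
rewrite (big_nat_widen _ _ _ _ _ lebn) big_geq_mkord.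
by apply: eq_bigl => x; rewrite andbC.
Qed.

(** For sets of one size, this is the triangle inequality for the Johnson
    distance [#|A| - #|A :&: C|]. *)
Lemma leq_card_setI_trans (T : finType) (A B C : {set T}) :
  #|A :&: B| + #|B :&: C| <= #|B| + #|A :&: C|.
Proof.
rewrite -cardsUI leq_add // subset_leq_card //.
  by rewrite subUset subsetIr subsetIl.
by rewrite setISS ?subsetIl ?subsetIr.
Qed.

Lemma disjoint_imset_inv (T : finType) (s : T -> T) (A B : {set T}) :
  involutive s -> [disjoint A & s @: B] = [disjoint s @: A & B].
Proof.
move=> sK; rewrite -!setI_eq0 -(inj_eq (imset_inj (inv_inj sK))) imset0.
rewrite imsetI; last by move=> x y _ _; apply: inv_inj.
congr (_ :&: _ == _); rewrite -imset_comp -[RHS]imset_id.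
by apply: eq_imset => x /=; rewrite sK.
Qed.

Lemma card_disjoint_imset (T : finType) (s : T -> T) (A : {set T}) :
  involutive s -> [disjoint A & s @: A] -> 2 * #|A| <= #|[set x | s x != x]|.
Proof.
move=> sK dA; rewrite mul2n -addnn -{2}(card_imset _ (inv_inj sK)).
rewrite -cardsUI (disjoint_setI0 dA) cards0 addn0 subset_leq_card //.
have mov x : x \in A -> s x != x.
  move=> Ax; apply: contraTneq dA => sx.
  by apply/pred0Pn; exists x; rewrite /= Ax -sx imset_f.
rewrite subUset; apply/andP; split; apply/subsetP => x; rewrite inE.
  exact: mov.
by case/imsetP=> y /mov sy ->; rewrite sK eq_sym.
Qed.

(** * Kneser graphs twisted by an involution *)

Section TwistedKneser.

Variables n k : nat.

Section Def.

Variables (s : 'I_n -> 'I_n) (sK : involutive s).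

Definition twisted_adj (A B : kneser_vertex n k) : bool :=
  [disjoint val A & s @: val B].

Lemma twisted_adj_sym A B : twisted_adj A B -> twisted_adj B A.
Proof. by rewrite /twisted_adj (disjoint_imset_inv _ _ sK) disjoint_sym. Qed.

Definition twisted_kneser : graph :=
  @Graph (kneser_vertex n k) twisted_adj twisted_adj_sym.

Lemma card_imset_vertex (A : kneser_vertex n k) : #|s @: val A| == k.
Proof. by rewrite card_imset ?(valP A) //; apply: inv_inj. Qed.

Definition twist_vertex (A : kneser_vertex n k) : kneser_vertex n k :=
  Sub (s @: val A) (card_imset_vertex A).

Lemma twist_vertexK : involutive twist_vertex.
Proof.
move=> A; apply: val_inj; rewrite /= -imset_comp -[RHS]imset_id.
by apply: eq_imset => x /=; rewrite sK.
Qed.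

Lemma twist_vertexE (A B : kneser_vertex n k) :
  [disjoint val A & val (twist_vertex B)] = twisted_adj A B.
Proof. by []. Qed.

Lemma simple_twisted_kneser :
  #|[set x | s x != x]| < 2 * k -> simple_graph twisted_kneser.
Proof.
move=> lt A dA; have := card_disjoint_imset sK dA.
by rewrite (eqP (valP A)) leqNgt lt.
Qed.

(** Only one of the two sheets is twisted.  An edge joins different sheets, so
    exactly one of its ends is moved by [s], which is what the adjacency of
    the twisted graph asks for. *)
Lemma twisted_kneser_cover :
  isomorphic (kronecker_cover twisted_kneser) (bipartite_kneser_graph n k).
Proof.
pose F (x : 'I_2 * kneser_vertex n k) :=
  (x.1, if x.1 == ord0 then x.2 else twist_vertex x.2).
have FK : involutive F.
  by case=> a A; rewrite /F /=; case: (a == ord0); rewrite ?twist_vertexK.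
have ord2 (a b : 'I_2) : a <> b -> (b == ord0) = (a != ord0).
  by case: a b => [[|[|?]] ?] [[|[|?]] ?] // [] //; apply: val_inj.
have twist0 (A B : kneser_vertex n k) :
    [disjoint val (twist_vertex A) & val B] = twisted_adj A B.
  by rewrite /twisted_adj (disjoint_imset_inv _ _ sK).
exists F; split; last exists F; last split=> //.
- case=> a A [b B] [/= ab AB]; split=> //=; rewrite (ord2 _ _ ab) /kneser_adj.
  by case: (a == ord0); rewrite /= ?twist0.
- case=> a A [b B] [/= ab AB]; split=> //=; rewrite (ord2 _ _ ab).
  change (is_true (twisted_adj (if a == ord0 then A else twist_vertex A)
                   (if a != ord0 then B else twist_vertex B))).
  case: (a == ord0); first by rewrite -twist_vertexE twist_vertexK.
  by rewrite -twist0 twist_vertexK.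
Qed.

(** A vertex adjacent to both [A] and [B] is any [k]-subset of the complement
    of [s @: (A :|: B)]. *)
Lemma card_common_neighbours (A B : kneser_vertex n k) :
  #|[set C | twisted_adj A C && twisted_adj B C]|
    = 'C(n - #|val A :|: val B|, k).
Proof.
have -> : n - #|val A :|: val B| = #|~: (s @: (val A :|: val B))|.
  by rewrite [RHS]cardsCs setCK card_ord card_imset //; apply: inv_inj.
rewrite -cards_draws -(card_imset _ val_inj); apply: eq_card => C.
rewrite !inE; apply/imsetP/andP => [[D]|[sC cC]].
  rewrite inE /twisted_adj !(disjoint_imset_inv _ _ sK) => /andP[dA dB] ->.
  rewrite (valP D) imsetU setCU subsetI -!disjoints_subset.
  by rewrite ![[disjoint val D & _]]disjoint_sym dA dB.
exists (Sub C cC) => //.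
rewrite inE /twisted_adj !(disjoint_imset_inv _ _ sK) /=.
move: sC; rewrite imsetU setCU subsetI -!disjoints_subset.
by rewrite ![[disjoint C & _]]disjoint_sym.
Qed.

End Def.

(** An equality of records, not only an isomorphism: the symmetry proofs are
    compared by proof irrelevance. *)
Lemma twisted_kneser_id (s : 'I_n -> 'I_n) (sK : involutive s) :
  s =1 id -> twisted_kneser sK = kneser_graph n k.
Proof.
move=> s1.
have eqG (r : kneser_vertex n k -> kneser_vertex n k -> Prop)
    (rS : forall A B, r A B -> r B A) :
  r = @kneser_adj n k -> Graph rS = kneser_graph n k.
  by move=> rE; subst r; congr Graph; apply: proof_irrelevance.
apply: eqG; apply: functional_extensionality => A.
apply: functional_extensionality => B.
by rewrite /twisted_adj (eq_imset _ s1) imset_id.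
Qed.

(** * Johnson distance *)

Lemma card_setI_vertex (A B : kneser_vertex n k) :
  k <= #|val A :&: val B| -> A = B.
Proof.
move=> le; apply: val_inj; apply/eqP.
rewrite eqEcard (eqP (valP A)) (eqP (valP B)) leqnn andbT.
apply/setIidPl/eqP.
by rewrite eqEcard subsetIl (eqP (valP A)).
Qed.

(** One step from [A] along a geodesic of the Johnson graph to [B]: a point of
    [A] outside [B] is replaced by a point of [B] outside [A]. *)
Lemma exchange_vertex (A B : kneser_vertex n k) :
  #|val A :&: val B| < k ->
  exists A' : kneser_vertex n k,
    k.-1 <= #|val A :&: val A'| /\ #|val A :&: val B| < #|val A' :&: val B|.
Proof.
move=> lt.
have [a] : exists a, a \in val A :\: val B.
  by apply/set0Pn; rewrite -card_gt0 cardsD (eqP (valP A)) subn_gt0.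
have [b] : exists b, b \in val B :\: val A.
  by apply/set0Pn; rewrite -card_gt0 cardsD (eqP (valP B)) subn_gt0 setIC.
rewrite !inE => /andP[Ab Bb] /andP[Ba Aa].
have cAa : #|val A :\ a|.+1 = k.
  by rewrite -[RHS](eqP (valP A)) (cardsD1 a (val A)) Aa.
have cA : #|b |: val A :\ a| == k.
  by rewrite cardsU1 !inE (negPf Ab) andbF add1n cAa.
exists (Sub (b |: val A :\ a) cA); split=> /=.
  have -> : k.-1 = #|val A :\ a| by lia.
  by rewrite subset_leq_card // subsetI subD1set subsetUr.
apply: proper_card; apply/properP; split.
  apply/subsetP => x; rewrite !inE => /andP[Ax Bx]; rewrite Ax Bx !andbT.
  by apply/orP; right; apply: contraNneq Ba => <-.
by exists b; rewrite !inE ?eqxx ?Bb // (negPf Ab).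
Qed.

(** A map sending sets at Johnson distance at most [1] to such sets does not
    increase the Johnson distance, by induction along a geodesic. *)
Lemma leq_card_setI_map (f : kneser_vertex n k -> kneser_vertex n k) :
    (forall A B, k.-1 <= #|val A :&: val B| ->
                 k.-1 <= #|val (f A) :&: val (f B)|) ->
  forall A B, #|val A :&: val B| <= #|val (f A) :&: val (f B)|.
Proof.
move=> fJ A B.
suff fd d : forall A B, k <= #|val A :&: val B| + d ->
                        k <= #|val (f A) :&: val (f B)| + d.
  have leI : #|val A :&: val B| <= k.
    by rewrite -[X in _ <= X](eqP (valP A)) subset_leq_card ?subsetIl.
  have := fd (k - #|val A :&: val B|) A B.
  by rewrite subnKC // => /(_ (leqnn _)); lia.
elim: d => [|d IHd] {}A {}B.
  rewrite !addn0 => /card_setI_vertex ->.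
  by rewrite setIid (eqP (valP (f B))).
have [le _|lt leS] := leqP k (#|val A :&: val B| + d).
  by have := IHd _ _ le; lia.
have [|A' [AA' A'B]] := @exchange_vertex A B; first by lia.
have := leq_card_setI_trans (val (f A)) (val (f A')) (val (f B)).
rewrite (eqP (valP (f A'))).
have := fJ _ _ AA'; have := IHd A' B.
lia.
Qed.

(** The number of common neighbours of two vertices cannot decrease under an
    injective homomorphism; as [k <= n - k.+1], it reaches ['C(n - k.+1, k)]
    exactly when the two vertices share at least [k - 1] points. *)
Lemma leq_card_setI_hom (s t : 'I_n -> 'I_n) (sK : involutive s)
    (tK : involutive t) (f : kneser_vertex n k -> kneser_vertex n k) :
    0 < k -> 2 * k < n ->
    @graph_hom (twisted_kneser sK) (twisted_kneser tK) f ->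
    injective f ->
  forall A B, #|val A :&: val B| <= #|val (f A) :&: val (f B)|.
Proof.
move=> k0 kn fh fI; apply: leq_card_setI_map => A B AB.
have cU (C D : kneser_vertex n k) :
    #|val C :|: val D| + #|val C :&: val D| = k + k.
  by rewrite cardsUI (eqP (valP C)) (eqP (valP D)).
have : 'C(n - k.+1, k) <= 'C(n - #|val (f A) :|: val (f B)|, k).
  apply: (@leq_trans 'C(n - #|val A :|: val B|, k)).
    by apply: leq_bin2l; have := cU A B; lia.
  rewrite -(card_common_neighbours sK) -(card_common_neighbours tK).
  rewrite -(card_imset _ fI) subset_leq_card //.
  apply/subsetP => _ /imsetP[C + ->]; rewrite !inE => /andP[AC BC].
  by apply/andP; split; apply: fh.
apply: contraLR; rewrite -!ltnNge => lt; apply: ltn_bin2l => //.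
  by lia.
by have := cU (f A) (f B); lia.
Qed.

End TwistedKneser.

(** * Products of disjoint transpositions *)

(** For [2 * i <= n] this exchanges [x] and [x + i] for every [x < i].  The
    default value [x] of [insubd], reached when [x + i] is not below [n], makes
    it an involution of ['I_n] without any assumption on [i]. *)
Definition block_swap n i (x : 'I_n) : 'I_n :=
  insubd x (if x < i then x + i else if x < 2 * i then x - i else x).

Lemma block_swapE n i (x : 'I_n) : 2 * i <= n ->
  block_swap i x =
    (if x < i then x + i else if x < 2 * i then x - i else x) :> nat.
Proof.
by move=> le; rewrite [LHS]val_insubd; have := ltn_ord x; repeat case: ifP; lia.
Qed.

Lemma block_swapK n i : involutive (@block_swap n i).
Proof.
move=> x; apply: val_inj; rewrite /block_swap !val_insubd /=.
have := ltn_ord x; repeat case: ifP; lia.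
Qed.

Lemma block_swap0 n : @block_swap n 0 =1 id.
Proof. by move=> x; apply: val_inj; rewrite /= block_swapE. Qed.

Lemma card_block_swap_moved n i :
  2 * i <= n -> #|[set x : 'I_n | block_swap i x != x]| <= 2 * i.
Proof.
move=> le; rewrite -[X in _ <= X]subn0 -(card_ord_interval 0 le).
apply: subset_leq_card; apply/subsetP => x.
rewrite !inE -val_eqE /= block_swapE //.
by repeat case: ifP; lia.
Qed.

(** The common part of the two sets is one point from each of the [i]
    transpositions; both are completed by fixed points, of which there are
    enough since [2 * (k - i) <= n - 2 * i]. *)
Lemma block_swap_edge n k i : i <= k -> 2 * k <= n ->
  exists A B : kneser_vertex n k,
    twisted_adj (block_swap i) A B /\ i <= #|val A :&: val B|.
Proof.
move=> leik lekn.
pose I a b := [set x : 'I_n | a <= x < b].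
have cI a b : a <= b -> i <= a -> b <= n -> #|I 0 i :|: I a b| = i + (b - a).
  move=> ab ia bn; rewrite cardsU !card_ord_interval //; last by lia.
  suff -> : I 0 i :&: I a b = set0 by rewrite cards0 !subn0.
  by apply/setP=> x; rewrite !inE; lia.
have cA : #|I 0 i :|: I (2 * i) (i + k)| == k by rewrite cI; lia.
have cB : #|I 0 i :|: I (i + k) (2 * k)| == k by rewrite cI; lia.
exists (Sub (I 0 i :|: I (2 * i) (i + k)) cA).
exists (Sub (I 0 i :|: I (i + k) (2 * k)) cB); split; last first.
  rewrite /= -[X in X <= _]subn0 -(@card_ord_interval n 0 i); last by lia.
  by rewrite subset_leq_card // subsetI !subsetUl.
rewrite /twisted_adj /=; apply/pred0P => y /=; apply/negP => /andP[Ay].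
case/imsetP=> x Bx yE; move: Ay Bx; rewrite {}yE !inE block_swapE; last by lia.
by repeat case: ifP; lia.
Qed.

Lemma block_swap_hom_leq n k i j
    (f : twisted_kneser k (@block_swapK n i) ->
         twisted_kneser k (@block_swapK n j)) :
  i < k -> j < k -> 2 * k < n -> graph_hom f -> injective f -> i <= j.
Proof.
move=> ik jk kn fh fI.
have [A [B [AB iAB]]] := block_swap_edge (ltnW ik) (ltnW kn).
have k0 : 0 < k by lia.
have leI := leq_card_setI_hom k0 kn fh fI A B.
have fAB : twisted_adj (block_swap j) (f A) (f B) := fh _ _ AB.
have {iAB leI} := leq_trans iAB leI; set D := _ :&: _ => iD.
have dD : [disjoint D & block_swap j @: D].
  exact: disjointW (subsetIl _ _) (imsetS _ (subsetIr _ _)) fAB.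
have le2j : 2 * j <= n by lia.
have := card_disjoint_imset (@block_swapK n j) dD.
move/leq_trans/(_ (card_block_swap_moved le2j)).
rewrite leq_pmul2l //; exact: leq_trans.
Qed.

Theorem theorem1 (n k : nat) (hk : 1 <= k) (hn : 2 * k < n) :
  exists G : 'I_k -> graph,
    [/\ forall i : 'I_k, simple_graph (G i),
        G (Ordinal hk) = kneser_graph n k,
        forall i : 'I_k,
          isomorphic (kronecker_cover (G i)) (bipartite_kneser_graph n k)
      & forall i j : 'I_k, i <> j -> ~ isomorphic (G i) (G j)].
Proof.
exists (fun i : 'I_k => twisted_kneser k (@block_swapK n i)); split.
- move=> i; apply: simple_twisted_kneser.
  have lt2 : 2 * i < 2 * k by rewrite ltn_pmul2l.
  exact/(leq_ltn_trans _ lt2)/card_block_swap_moved/ltnW/(ltn_trans lt2).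
- exact/twisted_kneser_id/block_swap0.
- by move=> i; apply: twisted_kneser_cover.
- move=> i j ij [f [fh [g [gh fK gK]]]]; apply: ij; apply: val_inj; apply/eqP.
  rewrite eqn_leq (block_swap_hom_leq _ _ hn fh (can_inj fK)) //.
  by rewrite (block_swap_hom_leq _ _ hn gh (can_inj gK)).
Qed.
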